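(* Let $\mathcal T$ be a Malcev theory and let $X$ be an inhabited simplicial algebra of $\mathcal T$ (i.e. $X_0$ is inhabited). Then $X$ is a degenerate-preferring Kan complex, i.e. the unique map of simplicial sets $X\to\Delta^0$ can be equipped with a function $\mathrm{lift}$ making it a degenerate-preferring Kan fibration.
   Context: Simplicial sets. $\Delta$ is the simplex category; $s_i:[n+1]\to[n]$ ($0\le i\le n$) is the surjective order-preserving map hitting $i$ twice, and $d_i$ is the injective order-preserving map skipping $i$. Elements $p\in X_n$ of a simplicial set are identified with maps $p:\Delta^n\to X$, and for $f:[m]\to[n]$ we write $p\circ f\in X_m$ for the result of the simplicial action. For $n\ge1$ and $0\le m\le n$, the horn $\Lambda^n_m\subseteq\Delta^n$ is the union of the faces $d_k$ with $k\neq m$, and $\iota:\Lambda^n_m\hookrightarrow\Delta^n$ is the horn inclusion. Algebras. An algebraic theory is a (single-sorted) theory whose axioms are equalities between terms. It is a Malcev theory if it has a Malcev operation: a ternary term $\mu$ for which $\mu(x,x,y)=y$ and $\mu(x,y,y)=x$ hold in the theory. A simplicial algebra of $\mathcal T$ is a functor from $\Delta^{op}$ to the category of models of $\mathcal T$. Kan fibrations. A functional Kan fibration is a map $\alpha:X\to Y$ of simplicial sets together with a function $\mathrm{lift}$ assigning to every horn inclusion $\iota:\Lambda^n_m\hookrightarrow\Delta^n$ and every pair $x:\Lambda^n_m\to X$, $y:\Delta^n\to Y$ with $\alpha\circ x=y\circ\iota$ a map $\mathrm{lift}(x,y):\Delta^n\to X$ with $\mathrm{lift}(x,y)\circ\iota=x$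 and $\alpha\circ\mathrm{lift}(x,y)=y$. It is a degenerate-preferring Kan fibration if, whenever a lifting problem $(x,y)$ has a solution of the form $z\circ s_j$ for some $z\in X_{n-1}$ and $0\le j\le n-1$, then $\mathrm{lift}(x,y)$ is such a solution (such degenerate solutions are unique when they exist). *)

(* Defs.v *)
From Stdlib Require FunctionalExtensionality ProofIrrelevance.
From HB Require Import structures.
From mathcomp Require Import all_boot.

Set Implicit Arguments.
Unset Strict Implicit.
Unset Printing Implicit Defensive.

(** * The simplex category

    The object [n] is the ordinal type ['I_n.+1].  Arrows are finite functions
    satisfying a boolean predicate, so that extensionally equal arrows are
    equal and each hom-set is a [finType]. *)

Definition monotone m n (f : {ffun 'I_m.+1 -> 'I_n.+1}) : bool :=
  [forall i : 'I_m.+1, forall j : 'I_m.+1, (i <= j) ==> (f i <= f j)].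

Record delta (m n : nat) := Delta {
  dfun :> {ffun 'I_m.+1 -> 'I_n.+1};
  dfun_monotone : monotone dfun }.

HB.instance Definition _ m n := [isSub for @dfun m n].
HB.instance Definition _ m n := [Equality of delta m n by <:].
HB.instance Definition _ m n := [Choice of delta m n by <:].
HB.instance Definition _ m n := [Countable of delta m n by <:].
HB.instance Definition _ m n := [Finite of delta m n by <:].

Lemma monotoneP m n (f : {ffun 'I_m.+1 -> 'I_n.+1}) :
  reflect (forall i j : 'I_m.+1, i <= j -> f i <= f j) (monotone f).
Proof.
apply: (iffP forallP) => [H i j|H i]; first by move/forallP/(_ j)/implyP: (H i).
by apply/forallP => j; apply/implyP; apply: H.
Qed.

Lemma delta_leq m n (f : delta m n) (i j : 'I_m.+1) : i <= j -> f i <= f j.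
Proof. by move/monotoneP: (dfun_monotone f); apply. Qed.

Lemma deltaP m n (f g : delta m n) : f =1 g -> f = g.
Proof. by move=> H; apply/val_inj/ffunP. Qed.

Lemma mk_delta_subproof m n (f : 'I_m.+1 -> 'I_n.+1) :
  (forall i j : 'I_m.+1, i <= j -> f i <= f j) -> monotone [ffun i => f i].
Proof. by move=> H; apply/monotoneP => i j ij; rewrite !ffunE; apply: H. Qed.

Definition mk_delta m n (f : 'I_m.+1 -> 'I_n.+1) H : delta m n :=
  Delta (@mk_delta_subproof m n f H).

Definition delta_id n : delta n n := @mk_delta n n id (fun _ _ h => h).

Definition delta_comp k m n (g : delta m n) (f : delta k m) : delta k n :=
  @mk_delta k n (fun i => g (f i)) (fun _ _ h => delta_leq g (delta_leq f h)).

Lemma delta_idE n i : delta_id n i = i.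
Proof. by rewrite ffunE. Qed.

Lemma delta_compE k m n (g : delta m n) (f : delta k m) i :
  delta_comp g f i = g (f i).
Proof. by rewrite ffunE. Qed.

Lemma delta_compA j k m n (h : delta m n) (g : delta k m) (f : delta j k) :
  delta_comp h (delta_comp g f) = delta_comp (delta_comp h g) f.
Proof. by apply: deltaP => i; rewrite !delta_compE. Qed.

Lemma delta_comp1 m n (f : delta m n) : delta_comp f (delta_id m) = f.
Proof. by apply: deltaP => i; rewrite delta_compE delta_idE. Qed.

Lemma coface_subproof n (i : 'I_n.+2) (a b : 'I_n.+1) :
  a <= b -> lift i a <= lift i b.
Proof. by rewrite /= leq_bump2. Qed.

Definition coface n (i : 'I_n.+2) : delta n n.+1 := mk_delta (@coface_subproof n i).

Lemma codegen_ord_subproof n (i : 'I_n.+1) (a : 'I_n.+2) : unbump i a < n.+1.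
Proof.
rewrite /unbump; case: (ltnP i a) => [ia|ai]; last first.
  by rewrite subn0 (leq_ltn_trans ai).
by rewrite subn1 prednK ?(leq_ltn_trans _ ia) // -ltnS ltn_ord.
Qed.

Definition codegen_ord n (i : 'I_n.+1) (a : 'I_n.+2) : 'I_n.+1 :=
  Ordinal (codegen_ord_subproof i a).

Lemma codegen_subproof n (i : 'I_n.+1) (a b : 'I_n.+2) :
  a <= b -> codegen_ord i a <= codegen_ord i b.
Proof.
rewrite /= /unbump => ab; case: (ltnP i a) => [ia|ai].
  by rewrite (leq_trans ia ab) leq_sub2r.
case: (ltnP i b) => [ib|_]; last by rewrite !subn0.
by rewrite subn0 subn1 (leq_trans ai) // -ltnS (ltn_predK ib).
Qed.

Definition codegen n (i : 'I_n.+1) : delta n.+1 n := mk_delta (@codegen_subproof n i).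

(** * Simplicial sets *)

Record sset := SSet {
  simplices :> nat -> Type;
  act : forall m n, delta m n -> simplices n -> simplices m;
  act_id : forall n (p : simplices n), act (delta_id n) p = p;
  act_comp : forall k m n (g : delta m n) (f : delta k m) (p : simplices n),
    act (delta_comp g f) p = act f (act g p) }.

Record smap (X Y : sset) := SMap {
  smap_fun :> forall n, X n -> Y n;
  smap_nat : forall m n (f : delta m n) (p : X n),
    smap_fun (act f p) = act f (smap_fun p) }.

Lemma smap_ext (X Y : sset) (a b : smap X Y) :
  (forall n (p : X n), a n p = b n p) -> a = b.
Proof.
case: a => a Ha; case: b => b Hb /= ab.
have eab : a = b.
  apply: FunctionalExtensionality.functional_extensionality_dep => n.
  exact: FunctionalExtensionality.functional_extensionality_dep.
by case: b / eab Hb {ab} => Hb; congr SMap; apply: ProofIrrelevance.proof_irrelevance.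
Qed.

Definition smap_comp (X Y Z : sset) (b : smap Y Z) (a : smap X Y) : smap X Z.
Proof.
exists (fun n p => b n (a n p)).
by move=> m n f p; rewrite !smap_nat.
Defined.

Definition simplex (n : nat) : sset.
Proof.
refine (@SSet (fun k => delta k n) (fun _ _ f p => delta_comp p f) _ _).
- by move=> k p; rewrite delta_comp1.
- by move=> j k m g f p; rewrite delta_compA.
Defined.

(** The map [simplex n -> X] identified with an element of [X n]. *)
Definition yoneda (X : sset) n (p : X n) : smap (simplex n) X.
Proof.
exists (fun k (f : delta k n) => act f p).
by move=> k m f g; rewrite -act_comp.
Defined.

Definition to_point (X : sset) : smap X (simplex 0).
Proof.
exists (fun k _ => @mk_delta k 0 (fun _ => ord0) (fun _ _ _ => leqnn _)).
by move=> m n f p; apply: deltaP => i; rewrite delta_compE !ffunE.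
Defined.

Lemma to_point_unique (X : sset) (a : smap X (simplex 0)) : a = to_point X.
Proof. by apply: smap_ext => n p; apply: deltaP => i; rewrite !ord1. Qed.

(** * Horns

    Horns live in dimension [n.+1], since they are only considered in positive
    dimension. *)

Definition in_face n (i : 'I_n.+2) k (f : delta k n.+1) : bool :=
  [exists g : delta k n, f == delta_comp (coface i) g].

Definition in_horn n (m : 'I_n.+2) k (f : delta k n.+1) : bool :=
  [exists i : 'I_n.+2, (i != m) && in_face i f].

Lemma in_horn_comp n (m : 'I_n.+2) j k (f : delta k n.+1) (g : delta j k) :
  in_horn m f -> in_horn m (delta_comp f g).
Proof.
case/existsP => i /andP[im /existsP[h /eqP ->]].
apply/existsP; exists i; rewrite im; apply/existsP.
by exists (delta_comp h g); rewrite delta_compA.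
Qed.

Definition horn n (m : 'I_n.+2) : sset.
Proof.
refine (@SSet (fun k => {f : delta k n.+1 | in_horn m f})
  (fun j k g f => exist _ (delta_comp (sval f) g) (in_horn_comp g (svalP f)))
  _ _).
- by move=> k p; apply: val_inj; rewrite /= delta_comp1.
- by move=> i j k g f p; apply: val_inj; rewrite /= delta_compA.
Defined.

Definition horn_incl n (m : 'I_n.+2) : smap (horn m) (simplex n.+1).
Proof. by exists (fun k (f : horn m k) => sval f). Defined.

(** * Kan fibrations *)

Record functional_kan (X Y : sset) (a : smap X Y) := FunctionalKan {
  kan_lift : forall n (m : 'I_n.+2)
    (x : smap (horn m) X) (y : smap (simplex n.+1) Y),
    smap_comp a x = smap_comp y (horn_incl m) -> smap (simplex n.+1) X;
  kan_lift_horn : forall n (m : 'I_n.+2) x y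
    (e : smap_comp a x = smap_comp y (horn_incl m)),
    smap_comp (kan_lift e) (horn_incl m) = x;
  kan_lift_over : forall n (m : 'I_n.+2) x y
    (e : smap_comp a x = smap_comp y (horn_incl m)),
    smap_comp a (kan_lift e) = y }.

Definition is_solution (X Y : sset) (a : smap X Y) n (m : 'I_n.+2)
    (x : smap (horn m) X) (y : smap (simplex n.+1) Y)
    (w : smap (simplex n.+1) X) : Prop :=
  smap_comp w (horn_incl m) = x /\ smap_comp a w = y.

Definition is_degenerate (X : sset) n (w : smap (simplex n.+1) X) : Prop :=
  exists (z : X n) (j : 'I_n.+1), w = yoneda (act (codegen j) z).

Definition degenerate_preferring (X Y : sset) (a : smap X Y)
    (K : functional_kan a) : Prop :=
  forall n (m : 'I_n.+2) (x : smap (horn m) X) (y : smap (simplex n.+1) Y)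
    (e : smap_comp a x = smap_comp y (horn_incl m)),
    (exists w, is_solution a x y w /\ is_degenerate w) ->
    is_degenerate (kan_lift K e).

Definition degenerate_preferring_kan_complex (X : sset) : Prop :=
  exists K : functional_kan (to_point X), degenerate_preferring K.

(** * Algebraic theories *)

Record signature := Signature {
  op_symbol :> Type;
  arity : op_symbol -> nat }.

Inductive term (S : signature) (V : Type) : Type :=
| Var (v : V)
| App (o : S) (args : 'I_(arity o) -> term S V).

Arguments Var {S V} v.
Arguments App {S V} o args.

Fixpoint subst (S : signature) (V W : Type) (s : V -> term S W)
    (t : term S V) : term S W :=
  match t with
  | Var v => s v
  | App o args => App o (fun i => subst s (args i))
  end.

Record theory := Theory {
  sig :> signature;
  equations : term sig nat -> term sig nat -> Prop }.

(** Equational logic: [derivable T t u] says that [t = u] is a theorem of [T]. *)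
Inductive derivable (T : theory) (V : Type) : term T V -> term T V -> Prop :=
| derivable_equations l r (s : nat -> term T V) :
    equations l r -> derivable (subst s l) (subst s r)
| derivable_refl t : derivable t t
| derivable_sym t u : derivable t u -> derivable u t
| derivable_trans t u v : derivable t u -> derivable u v -> derivable t v
| derivable_app (o : T) (a b : 'I_(arity o) -> term T V) :
    (forall i, derivable (a i) (b i)) -> derivable (App o a) (App o b).

Definition apply3 (S : signature) (V : Type) (mu : term S 'I_3)
    (a b c : term S V) : term S V :=
  subst (tnth [tuple a; b; c]) mu.

Definition is_malcev_operation (T : theory) (mu : term T 'I_3) : Prop :=
  let x : term T nat := Var 0 in
  let y : term T nat := Var 1 in
  derivable (apply3 mu x x y) y /\ derivable (apply3 mu x y y) x.

Definition is_malcev (T : theory) : Prop :=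
  exists mu : term T 'I_3, is_malcev_operation mu.

(** * Models and simplicial algebras *)

Fixpoint eval (S : signature) (A : Type)
    (op : forall o : S, ('I_(arity o) -> A) -> A) (V : Type) (env : V -> A)
    (t : term S V) : A :=
  match t with
  | Var v => env v
  | App o args => op o (fun i => eval op env (args i))
  end.

Record model (T : theory) := Model {
  carrier :> Type;
  op : forall o : T, ('I_(arity o) -> carrier) -> carrier;
  op_axiom : forall l r : term T nat, equations l r ->
    forall env : nat -> carrier, eval op env l = eval op env r }.

Record model_hom (T : theory) (A B : model T) := ModelHom {
  hom_fun :> A -> B;
  hom_op : forall (o : T) (a : 'I_(arity o) -> A),
    hom_fun (op a) = op (fun i => hom_fun (a i)) }.

Record salgebra (T : theory) := SAlgebra {
  salg :> nat -> model T;
  salg_act : forall m n, delta m n -> model_hom (salg n) (salg m);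
  salg_act_id : forall n (p : salg n), salg_act (delta_id n) p = p;
  salg_act_comp : forall k m n (g : delta m n) (f : delta k m) (p : salg n),
    salg_act (delta_comp g f) p = salg_act f (salg_act g p) }.

Definition underlying (T : theory) (X : salgebra T) : sset :=
  @SSet (fun n => X n) (fun m n f => salg_act X f)
    (@salg_act_id T X) (@salg_act_comp T X).

(* Main.v *)
From mathcomp Require Import all_boot zify.
From Stdlib Require FunctionalExtensionality.
Require Import Defs.

Set Implicit Arguments.
Unset Strict Implicit.
Unset Printing Implicit Defensive.

(** A Malcev operation [mu] allows a horn [x] to be filled by repairing an
    arbitrary simplex [w] one face at a time.  For each vertex [k != m] of the
    simplex let [e] be the retraction onto the face opposite to [k] that pushes
    [k] one step towards [m].  The simplex [mu (w, e^* w, x e)] agrees with [x]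
    on that face, because [mu (a, a, b) = b]; and a face on which [w] already
    agrees with [x] is not spoiled, because there the last two arguments
    coincide and [mu (a, b, b) = a], provided that [e] preserves this face.  The
    latter is ensured by treating the vertices farthest from [m] first
    ([push_before]), so after all the corrections [w] fills the horn
    ([fill_agrees], [agrees_horn]).

    The same corrections prefer degenerate fillers when they start from a
    totally degenerate simplex, which is where the inhabitant of [X 0] is used.
    Suppose that some filler [v] is [s_j]-degenerate.  This means that [v] is
    fixed by the retraction [push m j], which is [s_j] followed by the section
    of [s_j] that skips the vertex [lift m j] ([codegen_push]).  The
    simplex under repair is then fixed by this retraction until the turn of
    [lift m j] comes; at that moment the correction is [mu (w, w, v) = v], and
    the later ones are [mu (v, e^* v, e^* v) = v].  So the outcome is [v] itself
    ([fill_degenerate]). *)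

(** * Evaluation of terms in models *)

Lemma eval_ext (S : signature) (A : Type)
    (op : forall o : S, ('I_(arity o) -> A) -> A) (V : Type) (e e' : V -> A)
    (t : term S V) :
  e =1 e' -> eval op e t = eval op e' t.
Proof.
move=> ee'; elim: t => [v|o args IH] /=; first exact: ee'.
by congr (op o _); apply: FunctionalExtensionality.functional_extensionality_dep.
Qed.

Lemma eval_subst (S : signature) (A : Type)
    (op : forall o : S, ('I_(arity o) -> A) -> A) (V W : Type)
    (s : V -> term S W) (e : W -> A) (t : term S V) :
  eval op e (subst s t) = eval op (fun v => eval op e (s v)) t.
Proof.
elim: t => [v|o args IH] //=.
by congr (op o _); apply: FunctionalExtensionality.functional_extensionality_dep.
Qed.

Lemma derivable_sound (T : theory) (A : model T) (V : Type) (t u : term T V) :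
  derivable t u -> forall e : V -> A, eval (@op T A) e t = eval (@op T A) e u.
Proof.
elim=> {t u} [l r s lr|t|t u _ IH|t u v _ IH1 _ IH2|o a b _ IH] e //=.
- by rewrite !eval_subst; apply: op_axiom.
- by rewrite IH1.
congr (op _).
by apply: FunctionalExtensionality.functional_extensionality_dep => i; apply: IH.
Qed.

Lemma hom_eval (T : theory) (A B : model T) (h : model_hom A B) (V : Type)
    (e : V -> A) (t : term T V) :
  h (eval (@op T A) e t) = eval (@op T B) (fun v => h (e v)) t.
Proof.
elim: t => [v|o args IH] //=; rewrite hom_op.
by congr (op _); apply: FunctionalExtensionality.functional_extensionality_dep.
Qed.

(** * Malcev operations on simplicial sets *)

(** All that the filling of horns needs from an algebra of a Malcev theory. *)
Record malcev_structure (X : sset) := MalcevStructure {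
  malcev :> forall n, X n -> X n -> X n -> X n;
  act_malcev : forall m n (f : delta m n) (a b c : X n),
    act f (malcev a b c) = malcev (act f a) (act f b) (act f c);
  malcevL : forall n (a b : X n), malcev a a b = b;
  malcevR : forall n (a b : X n), malcev a b b = a }.

Definition eval3 (T : theory) (A : model T) (mu : term T 'I_3) (a b c : A) : A :=
  eval (@op T A) (tnth [tuple a; b; c]) mu.

Lemma eval3_apply3 (T : theory) (A : model T) (V : Type) (mu : term T 'I_3)
    (t u v : term T V) (e : V -> A) :
  eval (@op T A) e (apply3 mu t u v) =
  eval3 mu (eval (@op T A) e t) (eval (@op T A) e u) (eval (@op T A) e v).
Proof.
by rewrite eval_subst; apply: eval_ext; case; case=> [|[|[]]].
Qed.

Lemma malcev_structure_salgebra (T : theory) (X : salgebra T) :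
  is_malcev T -> inhabited (malcev_structure (underlying X)).
Proof.
case=> mu [muL muR].
have sound n (a b : X n) t u (tu : derivable t u) :=
  derivable_sound tu (fun i => if i is 0 then a else b).
split; exists (fun n => @eval3 T (X n) mu) => [m n f a b c|n a b|n a b] /=.
- by rewrite hom_eval; apply: eval_ext; case; case=> [|[|[]]].
- by have := sound n a b _ _ muL; rewrite eval3_apply3.
- by have := sound n a b _ _ muR; rewrite eval3_apply3.
Qed.

(** * Retractions of the simplex onto its faces *)

(** Skipping the vertex [lift m j] is the section of [codegen j] whose missing
    vertex is the one farther from [m] among [j] and [j.+1]; every face of the
    horn is skipped for exactly one [j]. *)
Definition push n (m : 'I_n.+2) (j : 'I_n.+1) : delta n.+1 n.+1 :=
  delta_comp (coface (lift m j)) (codegen j).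

Lemma codegen_coface n (m : 'I_n.+2) (j : 'I_n.+1) :
  delta_comp (codegen j) (coface (lift m j)) = delta_id n.
Proof.
apply: deltaP => i; rewrite delta_compE delta_idE !ffunE; apply: val_inj => /=.
rewrite /unbump /bump; lia.
Qed.

Lemma codegen_push n (m : 'I_n.+2) (j : 'I_n.+1) :
  delta_comp (codegen j) (push m j) = codegen j.
Proof.
rewrite /push delta_compA codegen_coface; apply: deltaP => i.
by rewrite delta_compE delta_idE.
Qed.

Lemma push_coface n (m : 'I_n.+2) (j : 'I_n.+1) :
  delta_comp (push m j) (coface (lift m j)) = coface (lift m j).
Proof. by rewrite /push -delta_compA codegen_coface delta_comp1. Qed.

Lemma push_idem n (m : 'I_n.+2) (j : 'I_n.+1) :
  delta_comp (push m j) (push m j) = push m j.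
Proof. by rewrite {1}/push -delta_compA codegen_push. Qed.

Lemma push_in_horn n (m : 'I_n.+2) (j : 'I_n.+1) : in_horn m (push m j).
Proof.
apply/existsP; exists (lift m j); rewrite eq_sym neq_lift.
by apply/existsP; exists (codegen j).
Qed.

Definition horn_push n (m : 'I_n.+2) (j : 'I_n.+1) : horn m n.+1 :=
  exist _ (push m j) (push_in_horn m j).

(** The distance from [m] to the vertex [lift m j]: the first truncated difference
    counts when [lift m j] is [j < m], the second when it is [j.+1 > m]. *)
Definition distance n (m : 'I_n.+2) (j : 'I_n.+1) : nat :=
  (m - j) + (j.+1 - m).

Definition before n (m : 'I_n.+2) : rel 'I_n.+1 :=
  fun j k => distance m k <= distance m j.

(** The only vertex moved by [push m k] is [lift m k], and it lands strictly
    closer to [m], hence not on [lift m j].  Therefore [push m k] preserves the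
    face opposite to [lift m j], which is the first identity; and [push m j]
    fixes the place where [lift m k] lands, which gives the second. *)
Lemma push_before n (m : 'I_n.+2) (j k : 'I_n.+1) :
  before m j k ->
  delta_comp (push m j) (delta_comp (push m k) (push m j)) =
    delta_comp (push m k) (push m j) /\
  delta_comp (push m k) (delta_comp (push m j) (push m k)) =
    delta_comp (push m k) (push m j).
Proof.
have pushE l (i : 'I_n.+2) : push m l i =
    (if (i == l + (m <= l) :> nat) then l + (l < m) else i) :> nat.
  rewrite delta_compE !ffunE /= /bump /unbump; case: eqP; lia.
rewrite /before /distance; move: (push m) pushE => e eE jk.
split; apply: deltaP => i; rewrite !delta_compE; apply: ord_inj; rewrite !eE;
  by do ![case: eqP] => *; lia.
Qed.

(** The order of the corrections: vertices farther from [m] come first. *)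
Definition vertices n (m : 'I_n.+2) : seq 'I_n.+1 :=
  sort (before m) (enum 'I_n.+1).

Lemma mem_vertices n (m : 'I_n.+2) j : j \in vertices m.
Proof. by rewrite mem_sort mem_enum. Qed.

Lemma pairwise_vertices n (m : 'I_n.+2) : pairwise (before m) (vertices m).
Proof.
rewrite -sorted_pairwise; last by move=> j i k ij jk; apply: leq_trans jk ij.
by apply: sort_sorted => j k; apply: leq_total.
Qed.

(** * Filling horns *)

Definition agrees (X : sset) n (m : 'I_n.+2) (x : smap (horn m) X) (w : X n.+1)
    (j : 'I_n.+1) : Prop :=
  act (push m j) w = x _ (horn_push m j).

(** Every simplex of the horn lies in the image of some [push m j], so agreement
    along these retractions is all that a filler has to satisfy. *)
Lemma agrees_horn (X : sset) n (m : 'I_n.+2) (x : smap (horn m) X) (w : X n.+1) :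
  (forall j, agrees x w j) <-> smap_comp (yoneda w) (horn_incl m) = x.
Proof.
split=> [agr|<- j //]; apply: smap_ext => k [f fm] /=.
have [j fE] : exists j, f = delta_comp (push m j) f.
  case/existsP: (fm) => i /andP[im /existsP[g /eqP ->]].
  have /unlift_some[j -> _] : m != i by rewrite eq_sym.
  by exists j; rewrite delta_compA push_coface.
rewrite [in LHS]fE act_comp agr -smap_nat; congr (x k _).
by apply: val_inj; rewrite /= -fE.
Qed.

Section Filling.

Context (X : sset) (M : malcev_structure X) (n : nat) (m : 'I_n.+2).
Context (x : smap (horn m) X).

Definition correct (w : X n.+1) (j : 'I_n.+1) : X n.+1 :=
  M _ w (act (push m j) w) (x _ (horn_push m j)).

Definition fill (w : X n.+1) : X n.+1 := foldl correct w (vertices m).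

Lemma correct_agrees w j : agrees x (correct w j) j.
Proof.
rewrite /agrees /correct act_malcev -act_comp push_idem malcevL -smap_nat.
by congr (x _ _); apply: val_inj; rewrite /= push_idem.
Qed.

Lemma correct_keeps w j k : before m j k -> agrees x w j -> agrees x (correct w k) j.
Proof.
case/push_before=> jkj _ wj; rewrite /agrees /correct act_malcev -act_comp.
(* By push_before the restricted correction only sees the face on which w is
   already right, so its last two arguments coincide. *)
have -> : act (delta_comp (push m k) (push m j)) w =
          act (push m j) (x _ (horn_push m k)).
  rewrite -{1}jkj act_comp wj -!smap_nat; congr (x _ _).
  by apply: val_inj; rewrite /= jkj.
by rewrite malcevR.
Qed.

Lemma fill_agrees w j : agrees x (fill w) j.
Proof.
rewrite /fill; have := mem_vertices m j; have := pairwise_vertices m.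
elim/last_ind: (vertices m) => [//|s k IH].
rewrite pairwise_rcons foldl_rcons mem_rcons in_cons => /andP[/allP sk s_ord].
case/predU1P=> [->|js]; first exact: correct_agrees.
by apply: correct_keeps (IH s_ord js); apply: sk.
Qed.

(** Being fixed by [push m k] survives the corrections made before the turn of
    [k]. *)
Lemma act_push_fixed (p : X n.+1) j k : before m j k ->
  act (push m k) p = p -> act (push m k) (act (push m j) p) = act (push m j) p.
Proof. by case/push_before=> _ kjk pk; rewrite -{1}pk -!act_comp kjk act_comp pk. Qed.

(** If [v] is degenerate, [push m k] fixes it for some [k], and the turn of [k]
    replaces the simplex under repair by [v], provided that this simplex is still
    fixed by [push m k]. *)
Lemma fill_degenerate w v k : act (push m k) w = w -> act (push m k) v = v ->
  (forall j, agrees x v j) -> fill w = v.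
Proof.
move=> wk vk agr; rewrite /fill.
have correctE u j : correct u j = M _ u (act (push m j) u) (act (push m j) v).
  by rewrite /correct agr.
have := mem_vertices m k; have := pairwise_vertices m.
elim/last_ind: (vertices m) => [//|s l IH].
rewrite pairwise_rcons foldl_rcons mem_rcons in_cons => /andP[sl s_ord].
case: (boolP (k \in s)) => [ks _|_]; first by rewrite IH // correctE malcevR.
rewrite orbF => /eqP kl; rewrite -{l}kl in sl *.
(* Until the turn of k, the simplex under repair stays fixed by its push. *)
suff fixed : act (push m k) (foldl correct w s) = foldl correct w s.
  by rewrite correctE fixed vk malcevL.
elim/last_ind: s sl {IH s_ord} => [//|s j IH].
rewrite all_rcons foldl_rcons => /andP[jk sk]; have uk := IH sk.
by rewrite correctE act_malcev !act_push_fixed ?uk.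
Qed.

End Filling.

(** * Degenerate-preferring Kan complexes *)

Lemma malcev_kan_complex (X : sset) :
  malcev_structure X -> X 0 -> degenerate_preferring_kan_complex X.
Proof.
move=> M p.
(* A totally degenerate simplex is fixed by every push. *)
pose base n : X n.+1 := act (to_point (simplex n.+1) _ (delta_id _)) p.
have act_base n (f : delta n.+1 n.+1) : act f (base n) = base n.
  by rewrite -act_comp; congr (act _ p); apply: deltaP => i; rewrite !ord1.
have to_point_eq n (a b : smap (simplex n) (simplex 0)) : a = b.
  by rewrite [a]to_point_unique [b]to_point_unique.
pose lift n (m : 'I_n.+2) x (y : smap (simplex n.+1) (simplex 0))
    (_ : smap_comp (to_point X) x = smap_comp y (horn_incl m)) :=
  yoneda (fill M x (base n)).
have lift_horn n (m : 'I_n.+2) x y e :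
    smap_comp (@lift n m x y e) (horn_incl m) = x.
  by apply/agrees_horn; apply: fill_agrees.
exists (FunctionalKan lift_horn (fun _ _ _ _ _ => to_point_eq _ _ _)).
move=> n m x y e [w [[wx _] [z [j wE]]]] /=; exists z, j.
rewrite /lift; congr yoneda; apply: (@fill_degenerate _ M n m x _ _ j) => //.
- by rewrite -act_comp codegen_push.
- by apply/agrees_horn; rewrite -wE.
Qed.

Theorem corollary3p11 (T : theory) (X : salgebra T) :
  is_malcev T -> inhabited (X 0) ->
  degenerate_preferring_kan_complex (underlying X).
Proof.
by move=> /(malcev_structure_salgebra X)[M] [p]; apply: malcev_kan_complex.
Qed.
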